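(* Let $(\mathcal K_n)_{n\ge 0}$ be one of the families $(\mathcal P_n)$, $(\mathcal B_n)$, $(\mathcal{PB}_n)$. The numbers $e(D_r(\mathcal K_n))$ satisfy the recurrence $$e(D_n(\mathcal K_n))=1,\qquad e(D_0(\mathcal K_n))=\rho(\mathcal K_n)^2,$$ $$e(D_r(\mathcal K_n))=\sum_{m=1}^n\binom{n-1}{m-1}\Big(c_0(\mathcal K_m)\,e(D_r(\mathcal K_{n-m}))+c_1(\mathcal K_m)\,e(D_{r-1}(\mathcal K_{n-m}))\Big)\quad\text{if }1\le r\le n-1,$$ where $\rho(\mathcal K_n)$ is the number of $\mathscr R$-classes (of $\mathcal K_n$) contained in $D_0(\mathcal K_n)$.
   Context: Write $\mathbf n=\{1,\dots,n\}$ and let $\mathbf n'$ be a disjoint copy. $\mathcal P_n$ is the monoid of all set partitions $\alpha$ (into non-empty blocks) of $\mathbf n\cup\mathbf n'$. Product: for $\alpha,\beta\in\mathcal P_n$ take a third copy $\mathbf n''$; relabel each lower vertex $x'$ of $\alpha$ as $x''$ and each upper vertex $x$ of $\beta$ as $x''$, and take the union graph $\Gamma(\alpha,\beta)$ on $\mathbf n\cup\mathbf n'\cup\mathbf n''$ (a partition being represented by a graph whose connected components are its blocks); $x,y\in\mathbf n\cup\mathbf n'$ are in the same block of $\alpha\beta$ iff they are joined by a path in $\Gamma(\alpha,\beta)$. $\mathcal{PB}_n$ is the submonoid of partitions all of whose blocks have size at most $2$, and $\mathcal B_n$ the submonoid of partitions all of whose blocks have size exactly $2$. $\mathcal P_0=\mathcal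 B_0=\mathcal{PB}_0=\{\emptyset\}$. The rank of $\alpha$ is the number of blocks meeting both $\mathbf n$ and $\mathbf n'$. $D_r(\mathcal K_n)=\{\alpha\in\mathcal K_n:\operatorname{rank}(\alpha)=r\}$ (empty if $r>n$). For $\alpha\in\mathcal P_n$, $\ker^\wedge(\alpha)$ (resp. $\ker_\vee(\alpha)$) is the equivalence on $\mathbf n$ relating $x,y$ iff $x,y$ (resp. $x',y'$) are in the same block of $\alpha$; $\ker(\alpha)=\ker^\wedge(\alpha)\vee\ker_\vee(\alpha)$ is the smallest equivalence containing both. $\alpha$ is irreducible if $\ker(\alpha)=\mathbf n\times\mathbf n$. For $\Sigma\subseteq\mathcal P_n$: $e(\Sigma)$ is the number of $\alpha\in\Sigma$ with $\alpha^2=\alpha$; for $r\in\{0,1\}$, $c_r(\Sigma)$ is the number of irreducible $\alpha\in\Sigma$ with $\alpha^2=\alpha$ and $\operatorname{rank}(\alpha)=r$. Green's relation $\mathscr R$ on a monoid $S$: $x\mathrel{\mathscr R}y$ iff $xS=yS$. *)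

(* Defs.v *)
From HB Require Import structures.
From mathcomp Require Import all_boot.

Set Implicit Arguments.
Unset Strict Implicit.
Unset Printing Implicit Defensive.

(* [inl x] is the upper vertex x and [inr x] the lower vertex x'; the points
   1, ..., n are numbered 0, ..., n - 1. *)
Definition vertex (n : nat) : finType := ('I_n + 'I_n)%type.

Record setpart (n : nat) := SetPart {
  blocks :> {set {set vertex n}};
  setpartP : partition blocks [set: vertex n] }.

HB.instance Definition _ n := [isSub for @blocks n].
HB.instance Definition _ n := [Finite of setpart n by <:].

Section Product.
Variable n : nat.
Implicit Types a b : setpart n.

Definition same_block a : rel (vertex n) := fun x y => y \in pblock a x.

Lemma same_blockE a x y : same_block a x y = (pblock a x == pblock a y).
Proof.
have /and3P[/eqP covT triv _] := setpartP a.
by rewrite /same_block eq_pblock // covT inE.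
Qed.

Lemma same_block_refl a : reflexive (same_block a).
Proof. by move=> x; rewrite same_blockE. Qed.

Lemma same_block_sym a : symmetric (same_block a).
Proof. by move=> x y; rewrite !same_blockE eq_sym. Qed.

Lemma same_block_trans a : transitive (same_block a).
Proof. by move=> y x z; rewrite !same_blockE => /eqP->. Qed.

(* Vertices of the product graph: [inl v] is a vertex v of the product, and
   [inr x] is the middle vertex x''. *)
Definition vertex3 : finType := (vertex n + 'I_n)%type.

Definition top_vertex (v : vertex n) : vertex3 :=
  match v with inl x => inl (inl x) | inr x => inr x end.

Definition bottom_vertex (v : vertex n) : vertex3 :=
  match v with inl x => inr x | inr x => inl (inr x) end.

(* A partition is represented by the graph in which any two vertices of a
   common block are adjacent. *)
Definition product_graph a b : rel vertex3 := fun u v =>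
  [exists x, exists y,
     [&& same_block a x y, u == top_vertex x & v == top_vertex y]]
  || [exists x, exists y,
     [&& same_block b x y, u == bottom_vertex x & v == bottom_vertex y]].

Definition product_rel a b : rel (vertex n) :=
  fun x y => connect (product_graph a b) (inl x) (inl y).

Lemma product_graph_sym a b : symmetric (product_graph a b).
Proof.
suff sub u v : product_graph a b u v -> product_graph a b v u.
  by move=> u v; apply/idP/idP; apply: sub.
by case/orP=> /existsP[x /existsP[y /and3P[xy ux vy]]]; apply/orP;
  [left | right]; apply/existsP; exists y; apply/existsP; exists x;
  rewrite same_block_sym xy ux vy.
Qed.

Lemma product_rel_equiv a b :
  {in [set: vertex n] & &, equivalence_rel (product_rel a b)}.
Proof.
move=> x y z _ _ _; split; first exact: connect0.
move=> xy; rewrite /product_rel.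
exact: (same_connect (sym_connect_sym (product_graph_sym a b)) xy).
Qed.

Definition pmul a b : setpart n :=
  SetPart (equivalence_partitionP (product_rel_equiv a b)).

Definition rank a : nat :=
  #|[set B in blocks a |
      [exists x : 'I_n, inl x \in B] && [exists x : 'I_n, inr x \in B]]|.

Definition upper_ker a : rel 'I_n := fun x y => same_block a (inl x) (inl y).

Definition lower_ker a : rel 'I_n := fun x y => same_block a (inr x) (inr y).

(* The join of two equivalences is the transitive closure of their union; see
   [ker_equiv], [upper_ker_sub], [lower_ker_sub] and [ker_least]. *)
Definition ker a : rel 'I_n :=
  connect (fun x y => upper_ker a x y || lower_ker a x y).

Lemma ker_equiv a : equivalence_rel (ker a).
Proof.
move=> x y z; split; first exact: connect0.
move=> xy; rewrite /ker; apply: (same_connect _ xy).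
apply: sym_connect_sym => u v.
by rewrite /upper_ker /lower_ker same_block_sym [in X in _ || X]same_block_sym.
Qed.

Lemma upper_ker_sub a : subrel (upper_ker a) (ker a).
Proof. by move=> x y xy; apply: connect1; rewrite xy. Qed.

Lemma lower_ker_sub a : subrel (lower_ker a) (ker a).
Proof. by move=> x y xy; apply: connect1; rewrite xy orbT. Qed.

Lemma ker_least a (E : rel 'I_n) :
    equivalence_rel E -> subrel (upper_ker a) E -> subrel (lower_ker a) E ->
  subrel (ker a) E.
Proof.
move=> eqE subU subL x y /connectP[p path_p ->{y}].
elim: p x path_p => [|y p IHp] x /=; first by move=> _; case: (eqE x x x).
case/andP=> xy /IHp Eyp; have [_ -> //] := eqE x y (last y p).
by case/orP: xy => [/subU | /subL].
Qed.

Definition irreducible a : bool := [forall x, forall y, ker a x y].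

Definition idempotent_part a : bool := pmul a a == a.

End Product.

Definition P_ (n : nat) : {set setpart n} := [set: setpart n].

Definition PB_ (n : nat) : {set setpart n} :=
  [set a : setpart n | [forall B in blocks a, #|B| <= 2]].

Definition B_ (n : nat) : {set setpart n} :=
  [set a : setpart n | [forall B in blocks a, #|B| == 2]].

Section Counting.
Variable n : nat.
Implicit Types (S : {set setpart n}) (a b : setpart n) (r : nat).

Definition D_ r S : {set setpart n} := [set a in S | rank a == r].

Definition e_ S : nat := #|[set a in S | idempotent_part a]|.

Definition c_ r S : nat :=
  #|[set a in S | [&& irreducible a, idempotent_part a & rank a == r]]|.

Definition right_ideal S a : {set setpart n} := [set pmul a s | s in S].

Definition greenR S : rel (setpart n) :=
  fun a b => right_ideal S a == right_ideal S b.

Definition Rclasses S : {set {set setpart n}} :=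
  equivalence_partition (greenR S) S.

Definition rho S : nat := #|[set C in Rclasses S | C \subset D_ 0 S]|.

End Counting.

(* Main.v *)
Require Import Defs.
From mathcomp Require Import all_boot.

Set Implicit Arguments.
Unset Strict Implicit.
Unset Printing Implicit Defensive.

(** The recurrence rests on a description of idempotents ([idempotentP]): a is
    idempotent if and only if each of its blocks lies over a single class of
    ker a, and each class carries at most one transversal block. Such a
    partition is the disjoint sum of its restrictions to the classes of its
    kernel, each of which is an irreducible idempotent of rank 0 or 1.
    Singling out the class A that contains a fixed vertex, a is obtained in
    exactly one way by gluing an irreducible idempotent on A to an idempotent
    on the complement of A ([glue_split], [card_ker_class]). Ranks add up
    under gluing, and the sizes of the blocks do not change; since there are
    'C(n - 1, m - 1) sets A with m elements that contain the fixed vertex, the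
    recurrence follows ([recurrence]). It holds for any family of partitions
    defined by a condition on block sizes, and the three families are of this
    form ([sized]).

    The number of idempotents of rank n is 1 since the kernel of such an
    idempotent must be trivial ([idempotent_rank_n]).

    A partition of rank 0 is a pair formed by a pattern on the upper row and a
    pattern on the lower row, and all such partitions are idempotent. Two of
    them are R-related if and only if they have the same upper pattern
    ([greenR_D0]), so that rho counts the upper patterns. Lower patterns are
    upper patterns of reflected partitions, and both can be chosen
    independently; whence the square ([idempotents_rank0]).

    The last point requires that each family is closed under products. For
    blocks of size at most 2, the components of the product graph are the
    orbits of two involutions, one for each factor, and the outer vertices are
    fixed points of these; an orbit of two involutions that contains a fixed
    point is a path with two ends ([fixed_by_either_unique],
    [fixed_by_either_exists]), so that a block of the product has at most two
    vertices, and exactly two if neither factor has a singleton block. *)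

(** * Partitions as equivalence relations *)

Lemma equivalence_sym (T : Type) (E : rel T) :
  equivalence_rel E -> symmetric E.
Proof. by case/equivalence_relP=> Er El x y; apply/idP/idP => /El<-. Qed.

Lemma relpre_equiv (T U : Type) (f : T -> U) (E : rel U) :
  equivalence_rel E -> equivalence_rel (relpre f E).
Proof. by move=> eqE x y z; apply: (eqE (f x) (f y) (f z)). Qed.

Definition sumrel (T U : Type) (E : rel T) (F : rel U) : rel (T + U) :=
  fun x y => match x, y with
  | inl x', inl y' => E x' y'
  | inr x', inr y' => F x' y'
  | _, _ => false
  end.

Lemma sumrel_equiv (T U : Type) (E : rel T) (F : rel U) :
  equivalence_rel E -> equivalence_rel F -> equivalence_rel (sumrel E F).
Proof.
case/equivalence_relP=> Er El /equivalence_relP[Fr Fl]; apply/equivalence_relP.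
split=> [[x|x]|[x|x] [y|y] //= xy [z|z]] //=.
  exact: El.
exact: Fl.
Qed.

(** The induction principle used for every join and every product below: a
    path cannot leave an equivalence that contains its edges. *)
Lemma connect_least (T : finType) (e E : rel T) :
  equivalence_rel E -> subrel e E -> subrel (connect e) E.
Proof.
case/equivalence_relP=> Er El sub_eE x y /connectP[p path_p ->{y}].
elim: p x path_p => [|y p IHp] x //= /andP[/sub_eE/El-> path_p].
exact: IHp.
Qed.

Lemma same_block_equiv n (a : setpart n) : equivalence_rel (same_block a).
Proof.
apply/equivalence_relP; split=> [x|x y xy z]; first exact: same_block_refl.
by move: xy; rewrite !same_blockE => /eqP->.
Qed.

(** Reduces equality of partitions to equality of relations, so that all later
    arguments can forget the sets of blocks. *)
Lemma setpart_eq n (a b : setpart n) :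
  same_block a =2 same_block b -> a = b.
Proof.
move=> eq_ab; apply: val_inj => /=.
rewrite -(equivalence_partition_pblock (setpartP a)).
rewrite -(equivalence_partition_pblock (setpartP b)).
apply: eq_imset => x; apply/setP=> y; rewrite !inE.
exact: (eq_ab x y).
Qed.

Definition of_equiv n (E : rel (vertex n)) (eqE : equivalence_rel E) :
    setpart n :=
  SetPart (equivalence_partitionP
    (fun x y z (_ : x \in [set: vertex n]) (_ : y \in [set: vertex n])
       (_ : z \in [set: vertex n]) => eqE x y z)).

Lemma same_block_of_equiv n (E : rel (vertex n)) (eqE : equivalence_rel E) :
  same_block (of_equiv eqE) =2 E.
Proof.
move=> x y; rewrite /same_block pblock_equivalence_partition ?inE //.
Qed.

Lemma same_block_pmul n (a b : setpart n) :
  same_block (pmul a b) =2 product_rel a b.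
Proof.
move=> x y; rewrite /same_block pblock_equivalence_partition ?inE //.
exact: product_rel_equiv.
Qed.

Definition index_of n (u : vertex n) : 'I_n :=
  match u with inl x => x | inr x => x end.

Definition id_part n : setpart n :=
  of_equiv (relpre_equiv (@index_of n)
    (fun x y z : 'I_n => (eqxx z, fun xy : x == y =>
       congr1 (eq_op^~ z) (eqP xy)))).

Lemma same_block_id n (u v : vertex n) :
  same_block (id_part n) u v = (index_of u == index_of v).
Proof. by rewrite same_block_of_equiv. Qed.

Definition pull m n (f : vertex m -> vertex n) (a : setpart n) : setpart m :=
  of_equiv (relpre_equiv f (same_block_equiv a)).

Lemma same_block_pull m n (f : vertex m -> vertex n) (a : setpart n) u v :
  same_block (pull f a) u v = same_block a (f u) (f v).
Proof. by rewrite same_block_of_equiv. Qed.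

Lemma mem_block n (a : setpart n) u v : (v \in pblock a u) = same_block a u v.
Proof. by []. Qed.

(** The three families are the cases where Q is trivial, [eq_op^~ 2] and
    [leq^~ 2]. Bounding the block of each vertex, rather than each block,
    makes the condition local, so that it is inherited by a partition glued
    from two parts. *)
Definition sized (Q : pred nat) n : {set setpart n} :=
  [set a : setpart n | [forall u, Q #|pblock a u|]].

Lemma forall_blocks n (a : setpart n) (Q : pred nat) :
  [forall B in blocks a, Q #|(B : {set vertex n})|] =
  [forall u, Q #|pblock a u|].
Proof.
have /and3P[/eqP covT triv set0N] := setpartP a.
apply/forall_inP/forallP => [QB u | Qu B aB].
  by apply: QB; apply: pblock_mem; rewrite covT inE.
have [B0|[u Bu]] := set_0Vmem B; first by rewrite -B0 aB in set0N.
by rewrite -(def_pblock triv aB Bu).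
Qed.

(** * Connectivity in the product graph *)

Section ProductDescription.
Variables (n : nat) (a b : setpart n).

(** The equivalence that the product graph induces on its middle row when only
    edges inside that row are used. For a = b it is [ker a], by definition. *)
Definition middle : rel 'I_n :=
  connect (fun x y => upper_ker b x y || lower_ker a x y).

Lemma middle_trans : transitive middle.
Proof. exact: connect_trans. Qed.

Lemma middle_refl : reflexive middle.
Proof. exact: connect0. Qed.

(** Adjacency to the middle component of z, for an outer vertex u; membership
    in it, for a middle vertex. *)
Definition touches (u : vertex3 n) : pred 'I_n := fun z =>
  match u with
  | inl (inl x) => [exists w, same_block a (inl x) (inr w) && middle w z]
  | inl (inr y) => [exists w, same_block b (inr y) (inl w) && middle w z]
  | inr w => middle w z
  end.

Definition direct (u v : vertex3 n) : bool :=
  match u, v with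
  | inl (inl x), inl (inl y) => same_block a (inl x) (inl y)
  | inl (inr x), inl (inr y) => same_block b (inr x) (inr y)
  | _, _ => false
  end.

Lemma product_graphP u v : reflect
  ((exists x y, [/\ same_block a x y, u = top_vertex x & v = top_vertex y]) \/
   (exists x y, [/\ same_block b x y, u = bottom_vertex x
                  & v = bottom_vertex y]))
  (product_graph a b u v).
Proof.
apply: (iffP orP) => -[H|H]; [left|right|left|right].
- by case/existsP: H => x /existsP[y /and3P[xy /eqP-> /eqP->]]; exists x, y.
- by case/existsP: H => x /existsP[y /and3P[xy /eqP-> /eqP->]]; exists x, y.
- case: H => x [y [xy -> ->]]; apply/existsP; exists x; apply/existsP.
  by exists y; rewrite xy !eqxx.
- case: H => x [y [xy -> ->]]; apply/existsP; exists x; apply/existsP.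
  by exists y; rewrite xy !eqxx.
Qed.

Lemma touches_graph u v z :
  product_graph a b u v -> touches v z -> touches u z.
Proof.
case/product_graphP=> -[[x|x] [[y|y] [xy -> ->]]] /=.
- case/existsP=> w /andP[yw wz]; apply/existsP; exists w.
  by rewrite (same_block_trans xy yw).
- by move=> yz; apply/existsP; exists y; rewrite xy.
- case/existsP=> w /andP[yw wz]; apply: middle_trans wz; apply: connect1.
  by rewrite /lower_ker (same_block_trans xy yw) orbT.
- by apply: middle_trans; apply: connect1; rewrite /lower_ker xy orbT.
- by apply: middle_trans; apply: connect1; rewrite /upper_ker xy.
- case/existsP=> w /andP[yw wz]; apply: middle_trans wz; apply: connect1.
  by rewrite /upper_ker (same_block_trans xy yw).
- by move=> yz; apply/existsP; exists y; rewrite xy.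
- case/existsP=> w /andP[yw wz]; apply/existsP; exists w.
  by rewrite (same_block_trans xy yw).
Qed.

Lemma direct_graph u v w : product_graph a b u v -> direct v w ->
  direct u w \/ exists z, touches u z && touches w z.
Proof.
case/product_graphP=> -[[x|x] [[y|y] [xy -> ->]]] //=; case: w => // -[] w //.
- by move=> yw; left; apply: same_block_trans yw.
- move=> yw; right; exists x; rewrite middle_refl; apply/existsP; exists x.
  by rewrite same_block_sym (same_block_trans xy yw) middle_refl.
- move=> yw; right; exists x; rewrite middle_refl; apply/existsP; exists x.
  by rewrite same_block_sym (same_block_trans xy yw) middle_refl.
- by move=> yw; left; apply: same_block_trans yw.
Qed.

Lemma connect_graph_equiv : equivalence_rel (connect (product_graph a b)).
Proof.
apply/equivalence_relP; split=> [u|u v uv w]; first exact: connect0.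
exact: same_connect (sym_connect_sym (@product_graph_sym _ a b)) _ _ uv w.
Qed.

Lemma upper_connect u v : same_block a u v ->
  connect (product_graph a b) (top_vertex u) (top_vertex v).
Proof.
by move=> uv; apply/connect1/product_graphP; left; exists u, v.
Qed.

Lemma lower_connect u v : same_block b u v ->
  connect (product_graph a b) (bottom_vertex u) (bottom_vertex v).
Proof.
by move=> uv; apply/connect1/product_graphP; right; exists u, v.
Qed.

Lemma middle_connect x y :
  middle x y -> connect (product_graph a b) (inr x) (inr y).
Proof.
apply: (connect_least (relpre_equiv inr connect_graph_equiv)) => u v /orP[|].
  exact: lower_connect.
exact: upper_connect.
Qed.

Lemma touches_connect u z :
  touches u z -> connect (product_graph a b) u (inr z).
Proof.
case: u => [[x|x]|x] /=; last exact: middle_connect.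
- case/existsP=> w /andP[xw /middle_connect wz].
  exact: connect_trans (upper_connect xw) wz.
- case/existsP=> w /andP[xw /middle_connect wz].
  exact: connect_trans (lower_connect xw) wz.
Qed.

(** A path between outer vertices either never visits the middle row, and is
    then a single edge by transitivity, or it visits it. The middle component
    visited is the same all along the path, because [touches] is constant
    along edges; so both ends touch it. *)
Lemma product_connectP u v : reflect
    (direct (inl u) (inl v) \/
       exists z, touches (inl u) z && touches (inl v) z)
    (product_rel a b u v).
Proof.
apply: (iffP idP) => [/connectP[p path_p /esym last_p]|].
  elim: p (inl u) path_p last_p => [|w p IHp] t /=.
    by move=> _ ->; left; case: (v) => x /=; apply: same_block_refl.
  case/andP=> tw path_p /(IHp w path_p)[wv|[z /andP[wz vz]]].
    exact: direct_graph tw wv.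
  by right; exists z; rewrite (touches_graph tw wz).
case=> [|[z /andP[uz vz]]].
  case: u v => x [] y //=; first exact: upper_connect.
  exact: lower_connect.
apply: connect_trans (touches_connect uz) _.
by rewrite (equivalence_sym connect_graph_equiv) touches_connect.
Qed.

End ProductDescription.

(** * Idempotents *)

Definition through n (a : setpart n) : rel 'I_n :=
  fun x y => same_block a (inl x) (inr y).

Lemma ker_sym n (a : setpart n) : symmetric (ker a).
Proof. exact: equivalence_sym (@ker_equiv n a). Qed.

Lemma ker_trans n (a : setpart n) : transitive (ker a).
Proof. exact: connect_trans. Qed.

Section IdempotentCriterion.
Variables (n : nat) (a : setpart n).

Lemma pmul_through x y :
  product_rel a a (inl x) (inr y) <->
  exists z w, [/\ through a x z, through a w y & ker a z w].
Proof.
split.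
  case/product_connectP=> //= -[z /andP[]] /existsP[u /andP[xu uz]].
  case/existsP=> w /andP[yw wz]; exists u, w; split=> //.
    by rewrite /through same_block_sym.
  by apply: ker_trans uz _; rewrite ker_sym.
case=> z [w [xz wy zw]]; apply/product_connectP; right; exists w.
apply/andP; split; apply/existsP; [exists z | exists w].
  by rewrite [same_block _ _ _]xz.
by rewrite same_block_sym [same_block _ _ _]wy middle_refl.
Qed.

(** Transversal blocks of a * a are obtained by welding transversal blocks of
    a along the classes of ker a. If a is idempotent, a block through x and y'
    is welded to itself by a middle path from y to x, so it stays inside one
    class of ker a; and two transversal blocks in the same class are welded
    together, hence equal. Conversely, if every class contains at most one
    transversal block and every block stays inside a class, welding changes
    nothing. *)
Lemma idempotentP : reflect
  ((forall x y, through a x y -> ker a x y) /\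
   (forall x y z w, through a x y -> through a z w -> ker a x z ->
      upper_ker a x z))
  (idempotent_part a).
Proof.
apply: (iffP eqP) => [idem_a | [sub_ker one_through]].
  have sub_ker x y : through a x y -> ker a x y.
    move=> xy; have := xy; rewrite /through -[in X in X -> _]idem_a.
    rewrite same_block_pmul => /pmul_through[z [w [xz wy zw]]].
    have /upper_ker_sub wx : upper_ker a w x.
      by apply: same_block_trans wy _; rewrite same_block_sym.
    have /lower_ker_sub zy : lower_ker a z y.
      by apply: same_block_trans xy; rewrite same_block_sym.
    rewrite ker_sym; apply: ker_trans wx; apply: ker_trans zw.
    by rewrite ker_sym.
  split=> // x y z w xy zw xz.
  rewrite /upper_ker -idem_a same_block_pmul; apply/product_connectP; right.
  exists w; apply/andP; split; apply/existsP; [exists y | exists w].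
    rewrite [same_block _ _ _]xy /=; apply: ker_trans (sub_ker _ _ zw).
    by apply: ker_trans xz; rewrite ker_sym sub_ker.
  by rewrite [same_block _ _ _]zw middle_refl.
have up x y z w : through a x z -> through a y w -> ker a z w ->
    same_block a (inl x) (inl y).
  move=> xz yw zw; apply: (one_through _ _ _ _ xz yw).
  apply: ker_trans (sub_ker _ _ xz) _; apply: ker_trans zw _.
  by rewrite ker_sym sub_ker.
apply: setpart_eq => u v; rewrite same_block_pmul; apply/idP/idP; last first.
  case: u v => x [] y xy; apply/product_connectP; [by left| | |by left].
    apply/product_connectP/pmul_through; exists y, x.
    by split=> //; rewrite ker_sym sub_ker.
  apply/product_connectP; rewrite /product_rel.
  rewrite (equivalence_sym (connect_graph_equiv a a)).
  rewrite same_block_sym in xy; apply/pmul_through; exists x, y.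
  by split=> //; rewrite ker_sym sub_ker.
case/product_connectP=> [|[z /andP[]]]; first by case: u v => x [].
have lem x y w1 w2 : through a x w1 -> same_block a (inr y) (inl w2) ->
   ker a w1 w2 -> same_block a (inl x) (inr y).
  move=> xw1 yw2 w12; rewrite same_block_sym in yw2.
  apply: (same_block_trans _ yw2); apply: (up _ _ _ _ xw1 yw2).
  by apply: (ker_trans w12 (sub_ker _ _ yw2)).
case: u v => x [] y /= /existsP[w1 /andP[xw wz]] /existsP[w2 /andP[yw w2z]];
  have w12 : ker a w1 w2 by apply: ker_trans wz _; rewrite ker_sym.
- exact: up xw yw w12.
- exact: lem xw yw w12.
- by rewrite same_block_sym; apply: (lem _ _ _ _ yw xw); rewrite ker_sym.
- rewrite same_block_sym in yw; apply: (same_block_trans _ yw).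
  apply: (same_block_trans xw); rewrite same_block_sym in xw.
  exact: (one_through _ _ _ _ xw yw w12).
Qed.

End IdempotentCriterion.

(** * Rank *)

Definition through_block n (a : setpart n) (x : 'I_n) : bool :=
  [exists y, through a x y].

Lemma rankE n (a : setpart n) :
  rank a = #|[set pblock a (inl x) | x in through_block a]|.
Proof.
have /and3P[/eqP covT triv _] := setpartP a.
apply: eq_card => B; rewrite inE; apply/idP/imsetP => [/and3P[aB]|].
  case/existsP=> x xB /existsP[y yB]; exists x; last first.
    by rewrite (def_pblock triv aB xB).
  apply/existsP; exists y.
  by rewrite /through -mem_block (def_pblock triv aB xB).
case=> x /existsP[y xy] ->; apply/and3P; split.
- by apply: pblock_mem; rewrite covT inE.
- by apply/existsP; exists x; rewrite mem_block same_block_refl.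
- by apply/existsP; exists y.
Qed.

Lemma rank0P n (a : setpart n) :
  reflect (forall x y, ~~ through a x y) (rank a == 0).
Proof.
rewrite rankE cards_eq0; apply: (iffP eqP) => [im0 x y | no_through].
  apply/negP=> xy; have : pblock a (inl x) \in set0.
    by rewrite -im0; apply: imset_f; apply/existsP; exists y.
  by rewrite inE.
apply/setP=> B; rewrite inE; apply/imsetP=> -[x /existsP[y xy] _].
by have := no_through x y; rewrite xy.
Qed.

(** This is why only c_0 and c_1 occur in the recurrence: an idempotent has at
    most one transversal block over each class of its kernel, and here there
    is a single class. *)
Lemma irreducible_rank n (a : setpart n) :
  irreducible a -> idempotent_part a -> rank a <= 1.
Proof.
move=> /forallP irr /idempotentP[_ one_through]; rewrite rankE.
apply/card_le1_eqP=> _ B /imsetP[x /existsP[y xy] ->].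
case/imsetP=> z /existsP[w zw] ->.
have /forallP/(_ x) zx := irr z.
by apply/eqP; rewrite -same_blockE; apply: (one_through _ _ _ _ zw xy).
Qed.

(** When the rank is n, the n upper vertices lie in n distinct transversal
    blocks. Since a class of ker a contains at most one of them, ker a is the
    equality, and each block is reduced to x and x'. *)
Lemma idempotent_rank_n n (a : setpart n) :
  (idempotent_part a && (rank a == n)) = (a == id_part n).
Proof.
apply/andP/eqP=> [[/idempotentP[sub_ker one_through]] | ->]; last first.
  split.
    apply/idempotentP; split=> [x y | x y z w].
      by rewrite /through same_block_id => /eqP/=->; apply: connect0.
    rewrite /through /upper_ker !same_block_id => _ _.
    apply: (ker_least (E := eq_op)) => [u v t|u v|u v].
    - by split=> // /eqP->.
    - by rewrite /upper_ker same_block_id.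
    - by rewrite /lower_ker same_block_id.
  rewrite rankE card_in_imset => [|x y _ _ /eqP].
    rewrite -[X in _ == X](card_ord n); apply/eqP/eq_card => x.
    rewrite [RHS]inE; apply/existsP; exists x.
    by rewrite /through same_block_id.
  by rewrite -same_blockE same_block_id => /eqP.
rewrite rankE => /eqP rk_n.
have card_through : #|through_block a| = n.
  apply/eqP; rewrite eqn_leq; apply/andP; split.
    by rewrite -[X in _ <= X](card_ord n) max_card.
  by rewrite -{1}rk_n leq_imset_card.
have allT x : through_block a x.
  have /subset_cardP sub : #|through_block a| = #|'I_n| by rewrite card_ord.
  by have := sub (subset_predT _) x; rewrite !inE.
have inj_upper : {in through_block a &, injective (fun x => pblock a (inl x))}.
  by apply/imset_injP; rewrite rk_n card_through.
have ker_eq x y : ker a x y -> x = y.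
  move=> xy; have /existsP[z xz] := allT x; have /existsP[w yw] := allT y.
  apply: inj_upper; [exact: allT | exact: allT | apply/eqP].
  by rewrite /= -same_blockE; apply: (one_through _ _ _ _ xz yw).
have through_refl x : through a x x.
  by have /existsP[y xy] := allT x; rewrite {2}(ker_eq _ _ (sub_ker _ _ xy)).
apply: setpart_eq => u v; rewrite same_block_id; apply/idP/eqP.
  case: u v => x [] y xy /=.
  - exact/ker_eq/upper_ker_sub.
  - exact/ker_eq/sub_ker.
  - by apply/esym/ker_eq/sub_ker; rewrite /through same_block_sym.
  - exact/ker_eq/lower_ker_sub.
have through_refl' x : same_block a (inr x) (inl x).
  by rewrite same_block_sym; apply: through_refl.
case: u v => x [] y /= ->.
- exact: same_block_refl.
- exact: through_refl.
- exact: through_refl'.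
- exact: same_block_refl.
Qed.

(** * Gluing along a two-part decomposition *)

Lemma card_disjointU (T : finType) (A B : {set T}) :
  A :&: B = set0 -> #|A :|: B| = #|A| + #|B|.
Proof. by move=> AB0; rewrite cardsU AB0 cards0 subn0. Qed.

Section Glue.
Variables (n p q : nat) (k : 'I_p + 'I_q -> 'I_n) (h : 'I_n -> 'I_p + 'I_q).
Hypotheses (kK : cancel k h) (hK : cancel h k).

Definition place_l (u : vertex p) : vertex n :=
  match u with inl i => inl (k (inl i)) | inr i => inr (k (inl i)) end.

Definition place_r (u : vertex q) : vertex n :=
  match u with inl i => inl (k (inr i)) | inr i => inr (k (inr i)) end.

Definition unplace (u : vertex n) : vertex p + vertex q :=
  match u with
  | inl x => match h x with inl i => inl (inl i) | inr j => inr (inl j) end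
  | inr x => match h x with inl i => inl (inr i) | inr j => inr (inr j) end
  end.

Lemma place_lK u : unplace (place_l u) = inl u.
Proof. by case: u => i /=; rewrite kK. Qed.

Lemma place_rK u : unplace (place_r u) = inr u.
Proof. by case: u => i /=; rewrite kK. Qed.

Variant placed : vertex n -> Prop :=
  | PlacedL u : placed (place_l u)
  | PlacedR u : placed (place_r u).

Lemma placedP u : placed u.
Proof.
by case: u => x; rewrite -(hK x); case: (h x) => i;
  [ exact: (PlacedL (inl i)) | exact: (PlacedR (inl i))
  | exact: (PlacedL (inr i)) | exact: (PlacedR (inr i))].
Qed.

(** The partition whose blocks are those of b, moved to the left part, and
    those of c, moved to the right part. *)
Definition glue (b : setpart p) (c : setpart q) : setpart n :=
  of_equiv (relpre_equiv unplace
    (sumrel_equiv (same_block_equiv b) (same_block_equiv c))).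

Lemma same_block_glue b c u v : same_block (glue b c) u v =
  sumrel (same_block b) (same_block c) (unplace u) (unplace v).
Proof. by rewrite same_block_of_equiv. Qed.

Lemma upper_ker_glue b c i j : upper_ker (glue b c) (k i) (k j) =
  sumrel (upper_ker b) (upper_ker c) i j.
Proof. by rewrite /upper_ker same_block_glue /= !kK; case: i j => i [] j. Qed.

Lemma lower_ker_glue b c i j : lower_ker (glue b c) (k i) (k j) =
  sumrel (lower_ker b) (lower_ker c) i j.
Proof. by rewrite /lower_ker same_block_glue /= !kK; case: i j => i [] j. Qed.

Lemma through_glue b c i j : through (glue b c) (k i) (k j) =
  sumrel (through b) (through c) i j.
Proof. by rewrite /through same_block_glue /= !kK; case: i j => i [] j. Qed.

Lemma ker_glue b c i j : ker (glue b c) (k i) (k j) =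
  sumrel (ker b) (ker c) i j.
Proof.
apply/idP/idP.
  have eqE := sumrel_equiv (@ker_equiv _ b) (@ker_equiv _ c).
  move=> /(ker_least (relpre_equiv h eqE)); rewrite /= !kK; apply=> x y.
    rewrite -{1}(hK x) -{1}(hK y) upper_ker_glue /=.
    by case: (h x) (h y) => x' [] y' //=; apply: upper_ker_sub.
  rewrite -{1}(hK x) -{1}(hK y) lower_ker_glue /=.
  by case: (h x) (h y) => x' [] y' //=; apply: lower_ker_sub.
have eqE := @ker_equiv _ (glue b c).
case: i j => i [] j //=.
  apply: (ker_least (relpre_equiv (fun i => k (inl i)) eqE)) => x y xy /=.
    by apply: upper_ker_sub; rewrite upper_ker_glue.
  by apply: lower_ker_sub; rewrite lower_ker_glue.
apply: (ker_least (relpre_equiv (fun i => k (inr i)) eqE)) => x y xy /=.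
  by apply: upper_ker_sub; rewrite upper_ker_glue.
by apply: lower_ker_sub; rewrite lower_ker_glue.
Qed.

Lemma idempotent_glue b c :
  idempotent_part (glue b c) = idempotent_part b && idempotent_part c.
Proof.
apply/idempotentP/andP => [[sub_ker one_through] | ].
  split; apply/idempotentP; split.
  - move=> x y xy; have := sub_ker (k (inl x)) (k (inl y)).
    by rewrite through_glue ker_glue; apply.
  - move=> x y z w xy zw xz.
    have := one_through (k (inl x)) (k (inl y)) (k (inl z)) (k (inl w)).
    by rewrite !through_glue ker_glue upper_ker_glue; apply.
  - move=> x y xy; have := sub_ker (k (inr x)) (k (inr y)).
    by rewrite through_glue ker_glue; apply.
  - move=> x y z w xy zw xz.
    have := one_through (k (inr x)) (k (inr y)) (k (inr z)) (k (inr w)).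
    by rewrite !through_glue ker_glue upper_ker_glue; apply.
case=> /idempotentP[sub_b one_b] /idempotentP[sub_c one_c]; split.
  move=> x y; rewrite -(hK x) -(hK y) through_glue ker_glue.
  by case: (h x) (h y) => x' [] y'; [apply: sub_b | | | apply: sub_c].
move=> x y z w; rewrite -(hK x) -(hK y) -(hK z) -(hK w).
rewrite !through_glue ker_glue upper_ker_glue.
case: (h x) (h y) (h z) (h w) => x' [] y' [] z' [] w' //=.
  exact: one_b.
exact: one_c.
Qed.

Lemma place_l_inj : injective place_l.
Proof. by move=> u v /(congr1 unplace); rewrite !place_lK => -[]. Qed.

Lemma place_r_inj : injective place_r.
Proof. by move=> u v /(congr1 unplace); rewrite !place_rK => -[]. Qed.

Lemma pblock_glue_l b c u :
  pblock (glue b c) (place_l u) = place_l @: pblock b u.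
Proof.
apply/setP=> v; rewrite mem_block same_block_glue place_lK.
case: (placedP v) => w.
  by rewrite place_lK mem_imset //; apply: place_l_inj.
rewrite place_rK; apply/esym/negP=> /imsetP[t _ /(congr1 unplace)].
by rewrite place_lK place_rK.
Qed.

Lemma pblock_glue_r b c u :
  pblock (glue b c) (place_r u) = place_r @: pblock c u.
Proof.
apply/setP=> v; rewrite mem_block same_block_glue place_rK.
case: (placedP v) => w; last first.
  by rewrite place_rK mem_imset //; apply: place_r_inj.
rewrite place_lK; apply/esym/negP=> /imsetP[t _ /(congr1 unplace)].
by rewrite place_lK place_rK.
Qed.

Lemma sized_glue Q b c :
  (glue b c \in sized Q n) = (b \in sized Q p) && (c \in sized Q q).
Proof.
rewrite !inE; apply/forallP/andP => [Qbc | [/forallP Qb /forallP Qc] u].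
  split; apply/forallP=> u.
    have := Qbc (place_l u).
    by rewrite pblock_glue_l card_imset //; apply: place_l_inj.
  have := Qbc (place_r u).
  by rewrite pblock_glue_r card_imset //; apply: place_r_inj.
case: (placedP u) => v.
  by rewrite pblock_glue_l card_imset //; apply: place_l_inj.
by rewrite pblock_glue_r card_imset //; apply: place_r_inj.
Qed.

Lemma through_block_glue b c i : through_block (glue b c) (k i) =
  match i with inl x => through_block b x | inr x => through_block c x end.
Proof.
apply/existsP/idP => [[y]|].
  rewrite -(hK y) through_glue; case: i (h y) => i [] j //= ij;
  by apply/existsP; exists j.
by case: i => i /existsP[j ij]; [exists (k (inl j)) | exists (k (inr j))];
  rewrite through_glue.
Qed.

(** A block is moved injectively and remains transversal or not; and no block
    of the left part is a block of the right part. *)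
Lemma rank_glue b c : rank (glue b c) = rank b + rank c.
Proof.
pose Fl := fun B : {set vertex p} => place_l @: B.
pose Fr := fun B : {set vertex q} => place_r @: B.
have Fl_inj : injective Fl by apply: imset_inj; apply: place_l_inj.
have Fr_inj : injective Fr by apply: imset_inj; apply: place_r_inj.
rewrite !rankE -(card_imset _ Fl_inj) -(card_imset _ Fr_inj).
rewrite -card_disjointU.
  congr #|pred_of_set _|; apply/setP=> B; rewrite inE; apply/imsetP/orP.
    case=> x; rewrite -(hK x) /in_mem /= through_block_glue.
    case: (h x) => i bi ->; [left | right]; apply/imsetP.
      exists (pblock b (inl i)); first exact: imset_f.
      exact: (pblock_glue_l b c (inl i)).
    exists (pblock c (inl i)); first exact: imset_f.
    exact: (pblock_glue_r b c (inl i)).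
  case=> /imsetP[_ /imsetP[i bi ->] ->].
    exists (k (inl i)); first by rewrite /in_mem /= through_block_glue.
    by rewrite /Fl -(pblock_glue_l b c (inl i)).
  exists (k (inr i)); first by rewrite /in_mem /= through_block_glue.
  by rewrite /Fr -(pblock_glue_r b c (inl i)).
apply/setP=> B; rewrite !inE; apply/negP.
case/andP=> /imsetP[_ /imsetP[i _ ->] ->] /imsetP[_ /imsetP[j _ ->]].
rewrite /Fl /Fr -(pblock_glue_l b c) -(pblock_glue_r b c) => /eqP.
by rewrite -same_blockE same_block_glue place_lK place_rK.
Qed.

Lemma glue_inj : injective (fun bc => glue bc.1 bc.2).
Proof.
move=> [b c] [b' c'] /= eq_glue; congr pair; apply: setpart_eq => u v.
  have := same_block_glue b c (place_l u) (place_l v).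
  by rewrite eq_glue same_block_glue !place_lK.
have := same_block_glue b c (place_r u) (place_r v).
by rewrite eq_glue same_block_glue !place_rK.
Qed.

Definition side (x : 'I_n) : bool := if h x is inl _ then true else false.

Lemma ker_class_glue b c x0 : side x0 ->
  ([set y | ker (glue b c) x0 y] == [set y | side y]) = irreducible b.
Proof.
rewrite /side; case h_x0 : (h x0) => [i0|//] _.
rewrite -(hK x0) h_x0; apply/eqP/forallP => [cl_i0 i | irr].
  have ker_i0 j : ker b i0 j.
    have: k (inl j) \in [set y | side y] by rewrite inE /side kK.
    by rewrite -cl_i0 inE ker_glue.
  by apply/forallP=> j; apply: ker_trans (ker_i0 j); rewrite ker_sym.
apply/setP=> y; rewrite !inE -(hK y) ker_glue /side kK.
by case: (h y) => //= j; have /forallP := irr i0; apply.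
Qed.

(** Every block of an idempotent lies over a single class of its kernel, so
    cutting along a class loses no block. *)
Lemma glue_split a x0 : side x0 ->
    idempotent_part a -> [set y | ker a x0 y] = [set y | side y] ->
  a = glue (pull place_l a) (pull place_r a).
Proof.
move=> side_x0 /idempotentP[sub_ker _] cl_x0; apply: setpart_eq => u v.
have sideE y : side y = ker a x0 y by have /setP/(_ y) := cl_x0; rewrite !inE.
have side_uv s t : same_block a s t -> side (index_of s) = side (index_of t).
  move=> st; rewrite !sideE.
  suff st_ker : ker a (index_of s) (index_of t).
    apply/idP/idP => x0s; first exact: ker_trans x0s st_ker.
    by apply: ker_trans x0s _; rewrite ker_sym.
  case: s t st => s [] t st /=.
  - exact: upper_ker_sub.
  - exact: sub_ker.
  - by rewrite ker_sym; apply: sub_ker; rewrite /through same_block_sym.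
  - exact: lower_ker_sub.
have side_l s : side (index_of (place_l s)).
  by case: s => s; rewrite /side /= kK.
have side_r s : ~~ side (index_of (place_r s)).
  by case: s => s; rewrite /side /= kK.
rewrite same_block_glue; case: (placedP u) (placedP v) => s [] t.
- by rewrite !place_lK /= same_block_pull.
- rewrite place_lK place_rK /=; apply/negP=> /side_uv st.
  by have := side_r t; rewrite -st side_l.
- rewrite place_lK place_rK /=; apply/negP=> /side_uv st.
  by have := side_r s; rewrite st side_l.
- by rewrite !place_rK /= same_block_pull.
Qed.

(** Gluing is a bijection from the pairs (b, c), with b an irreducible
    idempotent and c an idempotent with rank b + rank c = r, onto the
    idempotents of rank r whose kernel class at x0 is the left part. The two
    summands separate the possible ranks 0 and 1 of b. *)
Lemma card_ker_class Q x0 r : side x0 -> 0 < r ->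
  #|[set a in D_ r (sized Q n) | idempotent_part a &
       [set y | ker a x0 y] == [set y | side y]]| =
  c_ 0 (sized Q p) * e_ (D_ r (sized Q q)) +
  c_ 1 (sized Q p) * e_ (D_ (r - 1) (sized Q q)).
Proof.
move=> side_x0 r_gt0.
pose I s := [set b in sized Q p |
  [&& irreducible b, idempotent_part b & rank b == s]].
pose E s := [set c in D_ s (sized Q q) | idempotent_part c].
have -> : c_ 0 (sized Q p) * e_ (D_ r (sized Q q)) +
  c_ 1 (sized Q p) * e_ (D_ (r - 1) (sized Q q)) =
  #|setX (I 0) (E r) :|: setX (I 1) (E (r - 1))|.
  rewrite card_disjointU ?cardsX //.
  apply/setP=> -[b c]; rewrite !inE /=.
  case: (rank b =P 0) => [->|_] /=; by rewrite !andbF.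
rewrite -(card_imset _ glue_inj); congr #|pred_of_set _|.
have memE b c : (glue b c \in [set a in D_ r (sized Q n) | idempotent_part a &
       [set y | ker a x0 y] == [set y | side y]]) =
       ((b, c) \in setX (I 0) (E r) :|: setX (I 1) (E (r - 1))).
  rewrite in_set in_set sized_glue ker_class_glue // idempotent_glue rank_glue.
  rewrite !in_setU !in_setX ![_ \in I _]in_set ![_ \in E _]in_set.
  rewrite ![_ \in D_ _ _]in_set.
  case: (b \in _) => //=; case: (c \in _) => /=; last by rewrite !andbF.
  case irr: (irreducible b); last by rewrite ?andbF.
  case idb: (idempotent_part b); last by rewrite ?andbF.
  case: (idempotent_part c); last by rewrite ?andbF.
  have := irreducible_rank irr idb; case: (rank b) => [|[|//]] _ /=.
    by rewrite ?andbT ?orbF.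
  by rewrite ?andbT add1n -{1}(ltn_predK r_gt0) eqSS subn1.
apply/setP=> a; apply/idP/imsetP => [aS | [[b c] bc ->]]; last by rewrite memE.
have := aS; rewrite in_set => /and3P[_ ida /eqP cl].
exists (pull place_l a, pull place_r a); last exact: glue_split cl.
by rewrite -memE -(glue_split side_x0 ida cl).
Qed.

End Glue.

(** * Counting by the kernel class of a vertex *)

Lemma sub_setC1 (T : finType) (x : T) (B : {set T}) :
  (B \subset [set~ x]) = (x \notin B).
Proof. by rewrite -setCS setCK sub1set inE. Qed.

Lemma card_sets_through (T : finType) (x : T) m : 0 < m ->
  #|[set A : {set T} | (x \in A) && (#|A| == m)]| = 'C(#|T| - 1, m - 1).
Proof.
move=> m_gt0; have <- : #|[set~ x]| = #|T| - 1 by rewrite cardsC1 subn1.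
rewrite -cards_draws.
have inj : {in [set B : {set T} | B \subset [set~ x] & #|B| == m - 1] &,
    injective (fun B : {set T} => x |: B)}.
  move=> B C; rewrite !inE !sub_setC1 => /andP[xB _] /andP[xC _] eqBC.
  by rewrite -(setU1K xB) eqBC setU1K.
rewrite -(card_in_imset inj); congr #|pred_of_set _|.
apply/setP=> A; rewrite inE; apply/andP/imsetP => [[xA /eqP Am]|[B]].
  exists (A :\ x); last by rewrite setD1K.
  rewrite inE sub_setC1 setD11 /=.
  by rewrite -Am (cardsD1 x A) xA addKn.
rewrite inE sub_setC1 => /andP[xB /eqP Bm] ->.
by rewrite setU11 cardsU1 xB Bm subnKC.
Qed.

Lemma sum_sets_through (T : finType) (x : T) (F : nat -> nat) :
  \sum_(A : {set T} | x \in A) F #|A| =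
  \sum_(1 <= m < #|T|.+1) 'C(#|T| - 1, m - 1) * F m.
Proof.
transitivity (\sum_(A : {set T} | x \in A)
   \sum_(1 <= m < #|T|.+1 | #|A| == m) F m).
  apply: eq_bigr => A xA; under eq_bigl do rewrite eq_sym.
  rewrite big_nat1_eq ltnS max_card andbT card_gt0.
  by case: eqP xA => // ->; rewrite inE.
rewrite (exchange_big_dep xpredT) //= !big_seq; apply: eq_bigr => m.
rewrite mem_index_iota => /andP[m_gt0 _].
by rewrite -(card_sets_through x m_gt0) sum_nat_const cardsE.
Qed.

Definition ker_class n (a : setpart n) (x : 'I_n) : {set 'I_n} :=
  [set y | ker a x y].

(** The bijection of [card_ker_class] is applied to the enumerations of A and
    of its complement. *)
Lemma card_ker_class_eq Q n (A : {set 'I_n}) x r : x \in A -> 0 < r ->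
  #|[set a in D_ r (sized Q n) | idempotent_part a & ker_class a x == A]| =
  c_ 0 (sized Q #|A|) * e_ (D_ r (sized Q (n - #|A|))) +
  c_ 1 (sized Q #|A|) * e_ (D_ (r - 1) (sized Q (n - #|A|))).
Proof.
move=> xA r_gt0.
pose k (i : 'I_#|A| + 'I_#|~: A|) : 'I_n :=
  match i with inl i => enum_val i | inr j => enum_val j end.
have k_inj : injective k.
  move=> [i|i] [j|j] /= eq_ij.
  - by congr inl; apply: enum_val_inj.
  - by have := enum_valP j; rewrite -eq_ij inE enum_valP.
  - by have := enum_valP i; rewrite eq_ij inE enum_valP.
  - by congr inr; apply: enum_val_inj.
have [h kK hK] : bijective k.
  by apply: inj_card_bij => //; rewrite card_sum !card_ord cardsC card_ord.
have sideE y : side h y = (y \in A).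
  rewrite /side -{2}(hK y); case: (h y) => i /=; first by rewrite enum_valP.
  by have := enum_valP i; rewrite inE => /negPf->.
have <- : [set y | side h y] = A by apply/setP=> y; rewrite inE sideE.
rewrite (card_ker_class kK hK) ?sideE //.
have -> : [set y | side h y] = A by apply/setP=> y; rewrite inE sideE.
by have <- : #|~: A| = n - #|A| by rewrite cardsCs setCK card_ord.
Qed.

(** Idempotents are sorted according to the kernel class of the first vertex,
    and the possible classes according to their cardinal m. The identity holds
    for every family defined by block sizes. *)
Lemma recurrence Q n r : 0 < n -> 0 < r ->
  e_ (D_ r (sized Q n)) =
  \sum_(1 <= m < n.+1) 'C(n - 1, m - 1) *
    (c_ 0 (sized Q m) * e_ (D_ r (sized Q (n - m))) +
     c_ 1 (sized Q m) * e_ (D_ (r - 1) (sized Q (n - m)))).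
Proof.
case: n => // n _ r_gt0.
have := sum_sets_through (ord0 : 'I_n.+1) (fun m =>
    (c_ 0 (sized Q m) * e_ (D_ r (sized Q (n.+1 - m))) +
     c_ 1 (sized Q m) * e_ (D_ (r - 1) (sized Q (n.+1 - m))))).
rewrite card_ord => <-; rewrite /e_ -sum1_card.
rewrite (partition_big (fun a => ker_class a ord0) (fun A => ord0 \in A)) /=.
  apply: eq_bigr => A xA; rewrite -(card_ker_class_eq Q xA r_gt0) -sum1_card.
  by apply: eq_bigl => a; rewrite !inE -!andbA.
by move=> a _; rewrite inE; apply: connect0.
Qed.

(** * Orbits of two involutions *)

Definition involution_step (T : finType) (s t : T -> T) : rel T :=
  fun x y => (y == s x) || (y == t x).

Section TwoInvolutions.
Variables (T : finType) (s t : T -> T).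
Hypotheses (sK : involutive s) (tK : involutive t).

(** The orbits of the group generated by two involutions are cycles of their
    product. On such a cycle both involutions are reflections, and a
    reflection of a cycle with L points has one fixed point if L is odd, and 0
    or 2 if L is even. So on a cycle through a fixed point u of t there
    is exactly one other pair of a point and an involution fixing it. *)
Definition rotation x := s (t x).

Lemma rotation_inj : injective rotation.
Proof. exact: inj_comp (can_inj sK) (can_inj tK). Qed.

Lemma iter_rotation_inj i : injective (iter i rotation).
Proof. by elim: i => [//|i IHi] x y /rotation_inj/IHi. Qed.

Lemma rotation_t x : rotation (t x) = s x.
Proof. by rewrite /rotation tK. Qed.

Variable u : T.
Hypothesis tu : t u = u.

(** In terms of the position i on the cycle through u, t acts as i |-> - i;
    hence s acts as i |-> 1 - i, and the fixed points of t and s are the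
    solutions of 2i = 0 and 2i - 1 = 0 modulo the length of the cycle. *)
Lemma reflection_iter i : iter i rotation (t (iter i rotation u)) = u.
Proof.
elim: i => [//|i IHi]; rewrite [in X in t X]iterS iterSr.
by rewrite -[RHS]IHi; congr iter; rewrite /rotation !tK sK.
Qed.

Lemma fixed_t_iter i : t (iter i rotation u) = iter i rotation u ->
  iter i.*2 rotation u = u.
Proof.
by move=> fix_i; rewrite -addnn iterD -[X in iter i _ X]fix_i reflection_iter.
Qed.

Lemma fixed_s_iter i : s (iter i.+1 rotation u) = iter i.+1 rotation u ->
  iter i.*2.+1 rotation u = u.
Proof.
move=> fix_i; rewrite -addnn -addnS iterD -[X in iter i _ X]fix_i -rotation_t.
by rewrite -iterSr reflection_iter.
Qed.

Lemma iter_period m : iter m rotation u = u -> 0 < m ->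
  m < (order rotation u).*2 -> m = order rotation u.
Proof.
have small k : iter k rotation u = u -> k < order rotation u -> k = 0.
  by move=> ku /findex_iter; rewrite ku findex0.
move=> mu m_gt0 m_lt; have [/(small _ mu) m0|le_m] := ltnP m (order rotation u).
  by rewrite m0 in m_gt0.
apply/eqP; rewrite eqn_leq le_m andbT -subn_eq0; apply/eqP/small.
  by move: mu; rewrite -{1}(subnK le_m) iterD (iter_order rotation_inj).
by rewrite ltn_subLR // addnn.
Qed.

Lemma orbit_rotation v :
  connect (involution_step s t) u v = fconnect rotation u v.
Proof.
have symf := fconnect_sym rotation_inj.
apply/idP/idP=> [/connectP[q path_q ->]|].
  suff sub x : path (involution_step s t) x q -> fconnect rotation u x ->
      fconnect rotation u (last x q) by apply: sub path_q (connect0 _ _).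
  elim: q x {path_q} => [//|w q IHq] x /= /andP[xw path_q] ux.
  apply: IHq path_q _ => {q}.
  have utx : fconnect rotation u (t x).
    rewrite symf; rewrite -(iter_findex ux).
    rewrite -[X in fconnect _ _ X](reflection_iter (findex rotation u x)).
    exact: fconnect_iter.
  case/orP: xw => /eqP-> //; rewrite -rotation_t.
  exact: connect_trans utx (fconnect1 _ _).
apply: connect_sub => x _ /eqP<-.
apply: (@connect_trans _ _ (t x)); apply: connect1; rewrite /involution_step.
  by rewrite eqxx orbT.
by rewrite eqxx.
Qed.

Definition fixed_by_either x := (s x == x) || (t x == x).

(** A position i with 0 < i < L leaves a single solution for 2i or 2i - 1 to
    be a multiple of L, namely L itself. *)
Lemma fixed_by_either_period v :
    connect (involution_step s t) u v -> v != u -> fixed_by_either v ->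
  exists2 i, v = iter i rotation u &
    order rotation u = i.*2 \/ (order rotation u).+1 = i.*2.
Proof.
rewrite orbit_rotation => uv v_u fix_v; have lt_i := findex_max uv.
exists (findex rotation u v); first by rewrite iter_findex.
have: findex rotation u v != 0 by rewrite findex_eq0 eq_sym.
move: fix_v; rewrite /fixed_by_either -{1 2 3 4}(iter_findex uv) => fix_v.
case: (findex rotation u v) lt_i fix_v => // i lt_i fix_v _.
case/orP: fix_v => /eqP fix_i; [right | left].
  rewrite doubleS; congr _.+1; apply/esym/iter_period => //.
    exact: fixed_s_iter.
  by rewrite -doubleS leq_double ltnW.
apply/esym/iter_period => //; first exact: fixed_t_iter.
by rewrite ltn_double.
Qed.

(** The parity of the length decides which of s and t fixes the second point,
    and then its position is determined. *)
Lemma fixed_by_either_unique v w :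
  connect (involution_step s t) u v -> connect (involution_step s t) u w ->
  v != u -> w != u ->
  fixed_by_either v -> fixed_by_either w -> v = w.
Proof.
move=> uv uw vu wu fix_v fix_w.
have [i -> Li] := fixed_by_either_period uv vu fix_v.
have [j -> Lj] := fixed_by_either_period uw wu fix_w.
congr iter; apply: double_inj.
case: Li Lj => Li [] Lj; rewrite -Li -?Lj //.
  by have := odd_double j; rewrite -Lj /= Li odd_double.
by have := odd_double i; rewrite -Li /= Lj odd_double.
Qed.

Lemma fixed_by_either_exists : s u != u ->
  exists v, [/\ connect (involution_step s t) u v, v != u & fixed_by_either v].
Proof.
move=> su; have L_gt0 := order_gt0 rotation u; set L := order _ _ in L_gt0.
(* Position of the other end: it is a fixed point of t if the length is even,
   and of s if it is odd. *)
have [i i_lt iL] : exists2 i, 0 < i < L & i.*2 = L \/ i.*2 = L.+1.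
  have lt_double h : 0 < h -> h < h.*2.
    by move=> h_gt0; rewrite -addnn -{1}[h]addn0 ltn_add2l.
  move: (L./2) (odd L) (odd_double_half L) => h [];
    rewrite ?add0n => defL; last first.
    have h_gt0 : 0 < h by rewrite -double_gt0 defL.
    by exists h; [rewrite h_gt0 -defL lt_double | left].
  exists h.+1; last by right; rewrite -defL.
  rewrite /= -defL ltnS lt_double // lt0n; apply/eqP=> h0.
  case/eqP: su; rewrite -rotation_t tu -[LHS]/(iter 1 rotation u).
  by have := iter_order rotation_inj u; rewrite -/L -defL h0.
exists (iter i rotation u); case/andP: i_lt => i_gt0 lt_iL.
split.
- by rewrite orbit_rotation fconnect_iter.
- apply/eqP=> /(congr1 (findex rotation u)); rewrite findex_iter // findex0.
  by move=> i0; rewrite i0 in i_gt0.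
apply/orP; case: iL => iL; [right | left]; apply/eqP.
  apply: (@iter_rotation_inj i); rewrite reflection_iter -iterD addnn iL.
  by rewrite (iter_order rotation_inj).
rewrite -rotation_t; case: i i_gt0 iL {lt_iL} => // i _ [iL].
congr rotation; apply: (@iter_rotation_inj i.+1); rewrite reflection_iter.
by rewrite -iterD addSn addnn iL (iter_order rotation_inj).
Qed.

End TwoInvolutions.

Lemma involution_step_sym (T : finType) (s t : T -> T) :
  involution_step s t =2 involution_step t s.
Proof. by move=> x y; rewrite /involution_step orbC. Qed.

Lemma fixed_by_either_sym (T : finType) (s t : T -> T) :
  fixed_by_either s t =1 fixed_by_either t s.
Proof. by move=> x; rewrite /fixed_by_either orbC. Qed.

(** * Products of partitions with small blocks *)

(** Meant for blocks with at most two vertices, where it is an involution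
    whose fixed points are the singleton blocks. *)
Definition partner n (a : setpart n) (u : vertex n) : vertex n :=
  odflt u [pick v | same_block a u v && (v != u)].

Section Partner.
Variables (n : nat) (a : setpart n).
Hypothesis small : forall u, #|pblock a u| <= 2.

Lemma same_block_partner u v :
  same_block a u v = (v == u) || (v == partner a u).
Proof.
rewrite /partner; case: pickP => [w /andP[uw wu]|none] /=; last first.
  rewrite orbb; have [->|vu] := eqVneq; first exact: same_block_refl.
  by have := none v; rewrite vu andbT.
apply/idP/orP => [uv|[/eqP->|/eqP-> //]]; last exact: same_block_refl.
have [->|vu] := eqVneq v u; [by left | right].
have := small u; rewrite (cardsD1 u) mem_block same_block_refl ltnS.
by move/card_le1_eqP=> eq1; apply/eqP/eq1; rewrite in_setD1 mem_block ?vu ?wu.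
Qed.

Lemma partner_block u : same_block a u (partner a u).
Proof. by rewrite same_block_partner eqxx orbT. Qed.

Lemma partnerK : involutive (partner a).
Proof.
move=> u; have := partner_block u; rewrite same_block_sym same_block_partner.
by case/orP=> /eqP eq_u; rewrite -!eq_u.
Qed.

End Partner.

Section ProductPaths.
Variables (n : nat) (a b : setpart n).
Hypotheses (small_a : forall u, #|pblock a u| <= 2)
  (small_b : forall u, #|pblock b u| <= 2).

(** When all blocks have at most two vertices, the product graph is given by
    two partial matchings. Extended by the identity, these become involutions,
    whose orbits are the components of the graph. *)
Definition top_swap (u : vertex3 n) : vertex3 n :=
  match u with
  | inl (inl x) => top_vertex (partner a (inl x))
  | inl (inr x) => inl (inr x)
  | inr x => top_vertex (partner a (inr x))
  end.

Definition bottom_swap (u : vertex3 n) : vertex3 n :=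
  match u with
  | inl (inl x) => inl (inl x)
  | inl (inr x) => bottom_vertex (partner b (inr x))
  | inr x => bottom_vertex (partner b (inl x))
  end.

Lemma top_swapE u : top_swap (top_vertex u) = top_vertex (partner a u).
Proof. by case: u. Qed.

Lemma bottom_swapE u :
  bottom_swap (bottom_vertex u) = bottom_vertex (partner b u).
Proof. by case: u. Qed.

Lemma top_swapK : involutive top_swap.
Proof.
move=> [[x|//]|x].
  by rewrite -[inl (inl x)]/(top_vertex (inl x)) !top_swapE partnerK.
by rewrite -[inr x]/(top_vertex (inr x)) !top_swapE partnerK.
Qed.

Lemma bottom_swapK : involutive bottom_swap.
Proof.
move=> [[//|x]|x].
  by rewrite -[inl (inr x)]/(bottom_vertex (inr x)) !bottom_swapE partnerK.
by rewrite -[inr x]/(bottom_vertex (inl x)) !bottom_swapE partnerK.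
Qed.

Lemma connect_swaps :
  connect (product_graph a b) =2 connect (involution_step top_swap bottom_swap).
Proof.
move=> u v; apply/idP/idP; apply: connect_sub => {u v} u v.
  case/product_graphP=> -[x [y [xy -> ->]]]; move: xy.
    rewrite same_block_partner // => /orP[/eqP->|/eqP->]; first exact: connect0.
    by rewrite -top_swapE; apply: connect1; rewrite /involution_step eqxx.
  rewrite same_block_partner // => /orP[/eqP->|/eqP->]; first exact: connect0.
  by rewrite -bottom_swapE; apply: connect1; rewrite /involution_step eqxx orbT.
case/orP=> /eqP->; case: u => [[x|x]|x]; try exact: connect0.
- exact: upper_connect (partner_block small_a (inl x)).
- exact: upper_connect (partner_block small_a (inr x)).
- exact: lower_connect (partner_block small_b (inr x)).
- exact: lower_connect (partner_block small_b (inl x)).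
Qed.

Lemma fixed_by_either_outer v : fixed_by_either top_swap bottom_swap (inl v).
Proof. by case: v => x; rewrite /fixed_by_either /= eqxx ?orbT. Qed.

Lemma pblock_pmul u v : (v \in pblock (pmul a b) u) =
  connect (involution_step top_swap bottom_swap) (inl u) (inl v).
Proof. by rewrite mem_block same_block_pmul -connect_swaps. Qed.

(** Every outer vertex is fixed by one of the two involutions; an orbit
    through such a fixed point contains at most one further fixed point. *)
Lemma pmul_small u : #|pblock (pmul a b) u| <= 2.
Proof.
rewrite (cardsD1 u) mem_block same_block_refl ltnS; apply/card_le1_eqP=> v w.
rewrite !in_setD1 !pblock_pmul => /andP[vu uv] /andP[wu uw].
suff: inl v = inl w :> vertex3 n by case.
have inlE x y : ((inl x : vertex3 n) == inl y) = (x == y) by [].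
case: u uv uw vu wu => x uv uw vu wu.
  by apply: (fixed_by_either_unique top_swapK bottom_swapK _ uv uw);
    rewrite ?inlE ?fixed_by_either_outer.
rewrite (eq_connect (involution_step_sym _ _)) in uv.
rewrite (eq_connect (involution_step_sym _ _)) in uw.
by apply: (fixed_by_either_unique bottom_swapK top_swapK _ uv uw);
  rewrite ?inlE // fixed_by_either_sym fixed_by_either_outer.
Qed.

(** Without singleton blocks no middle vertex is fixed and an outer vertex is
    fixed by one involution only; so the orbit has a second fixed point, and
    it is an outer vertex. *)
Lemma pmul_full u :
    (forall w, partner a w != w) -> (forall w, partner b w != w) ->
  1 < #|pblock (pmul a b) u|.
Proof.
move=> full_a full_b.
have top_inj : injective (@top_vertex n) by move=> [x|x] [y|y] // [->].
have bottom_inj : injective (@bottom_vertex n) by move=> [x|x] [y|y] // [->].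
have top_free w : top_swap (top_vertex w) != top_vertex w.
  by rewrite top_swapE (inj_eq top_inj).
have bottom_free w : bottom_swap (bottom_vertex w) != bottom_vertex w.
  by rewrite bottom_swapE (inj_eq bottom_inj).
have [v [uv vu fix_v]] : exists v,
    [/\ connect (involution_step top_swap bottom_swap) (inl u) v, v != inl u
      & fixed_by_either top_swap bottom_swap v].
  case: u => x.
    apply: (fixed_by_either_exists top_swapK bottom_swapK) => //.
    exact: (top_free (inl x)).
  have [//|v [uv vu fix_v]] :=
    fixed_by_either_exists bottom_swapK top_swapK _ (bottom_free (inr x)).
  exists v.
  by rewrite (eq_connect (involution_step_sym _ _)) fixed_by_either_sym.
case: v uv vu fix_v => [v|x] uv vu; last first.
  case/orP; first by rewrite (negPf (top_free (inr x))).
  by rewrite (negPf (bottom_free (inl x))).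
move=> _; rewrite (cardsD1 u) mem_block same_block_refl ltnS card_gt0.
by apply/set0Pn; exists v; rewrite in_setD1 pblock_pmul uv andbT.
Qed.

End ProductPaths.

Lemma sized_le2_pmul n (a b : setpart n) :
  a \in sized (leq^~ 2) n -> b \in sized (leq^~ 2) n ->
  pmul a b \in sized (leq^~ 2) n.
Proof.
rewrite !inE => /forallP small_a /forallP small_b.
by apply/forallP; apply: pmul_small.
Qed.

Lemma sized_eq2_pmul n (a b : setpart n) :
  a \in sized (eq_op^~ 2) n -> b \in sized (eq_op^~ 2) n ->
  pmul a b \in sized (eq_op^~ 2) n.
Proof.
rewrite !inE => /forallP size_a /forallP size_b.
have small (c : setpart n) :
    (forall u, #|pblock c u| == 2) -> forall u, #|pblock c u| <= 2.
  by move=> size_c u; rewrite (eqP (size_c u)).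
have full (c : setpart n) : (forall u, #|pblock c u| == 2) ->
    forall u, partner c u != u.
  move=> size_c u; apply/eqP=> pu; have := size_c u.
  rewrite (cardsD1 u) mem_block same_block_refl eqSS => /eqP D1.
  have /card_gt0P[v] : 0 < #|pblock c u :\ u| by rewrite D1.
  rewrite in_setD1 mem_block same_block_partner ?pu ?orbb ?andNb //.
  exact: small.
apply/forallP=> u; rewrite eqn_leq; apply/andP; split.
  by apply: pmul_small; apply: small.
by apply: pmul_full; [apply: small | apply: small | apply: full | apply: full].
Qed.

(** * Partitions of rank zero and their R-classes *)

(** This gives that a belongs to its own right ideal. *)
Lemma pmul_id n (a : setpart n) : pmul a (id_part n) = a.
Proof.
(* The middle row is collapsed onto the lower row. *)
pose squash (u : vertex3 n) : vertex n :=
  match u with inl v => v | inr x => inr x end.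
have squash_top u : squash (top_vertex u) = u by case: u.
have squash_bottom u : squash (bottom_vertex u) = inr (index_of u) by case: u.
apply: setpart_eq => u v; rewrite same_block_pmul; apply/idP/idP => [|uv].
  apply: (connect_least (relpre_equiv squash (same_block_equiv a))) => x y /=.
  case/product_graphP=> -[s [t [st -> ->]]]; first by rewrite !squash_top.
  move: st; rewrite same_block_id !squash_bottom => /eqP->.
  exact: same_block_refl.
have top_conn w :
    connect (product_graph a (id_part n)) (inl w) (top_vertex w).
  case: w => x; first exact: connect0.
  by apply: (@lower_connect _ _ _ (inr x) (inl x)); rewrite same_block_id.
apply: connect_trans (top_conn u) _.
apply: connect_trans (upper_connect _ uv) _.
by rewrite (equivalence_sym (connect_graph_equiv _ _)).
Qed.

Lemma sized_id (Q : pred nat) n : Q 2 -> id_part n \in sized Q n.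
Proof.
move=> Q2; rewrite inE; apply/forallP=> u.
have -> : pblock (id_part n) u = [set inl (index_of u); inr (index_of u)].
  apply/setP=> v; rewrite mem_block same_block_id !inE eq_sym.
  by case: v => x; rewrite /= ?orbF.
by rewrite cards2.
Qed.

Section RankZero.
Variable n : nat.
Implicit Types a b : setpart n.

Lemma upper_ker_pmul a b : rank a = 0 -> upper_ker (pmul a b) =2 upper_ker a.
Proof.
move/eqP/rank0P=> no_a x y; rewrite /upper_ker same_block_pmul.
apply/product_connectP/idP => [[//|[z /andP[/existsP[w]]]] | xy]; last by left.
by case/andP=> xw; have := no_a x w; rewrite /through xw.
Qed.

Lemma lower_ker_pmul a b : rank b = 0 -> lower_ker (pmul a b) =2 lower_ker b.
Proof.
move/eqP/rank0P=> no_b x y; rewrite /lower_ker same_block_pmul.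
apply/product_connectP/idP => [[//|[z /andP[/existsP[w]]]] | xy]; last by left.
by case/andP=> xw; have := no_b w x; rewrite /through same_block_sym xw.
Qed.

Lemma rank_pmul a b : rank a = 0 -> rank (pmul a b) = 0.
Proof.
move/eqP/rank0P=> no_a; apply/eqP/rank0P=> x y; apply/negP.
rewrite /through same_block_pmul.
case/product_connectP=> [//|[z /andP[/existsP[w]]]].
by case/andP=> xw; have := no_a x w; rewrite /through xw.
Qed.

Lemma rank0_eq a b : rank a = 0 -> rank b = 0 ->
  upper_ker a =2 upper_ker b -> lower_ker a =2 lower_ker b -> a = b.
Proof.
move=> /eqP/rank0P no_a /eqP/rank0P no_b eqU eqL; apply: setpart_eq.
move=> [x|x] [y|y]; [exact: eqU | | | exact: eqL].
  by rewrite [LHS](negPf (no_a x y)) [RHS](negPf (no_b x y)).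
rewrite same_block_sym [RHS]same_block_sym.
by rewrite [LHS](negPf (no_a y x)) [RHS](negPf (no_b y x)).
Qed.

Definition swap (u : vertex n) : vertex n :=
  match u with inl x => inr x | inr x => inl x end.

Lemma swapK : involutive swap.
Proof. by case. Qed.

Definition flip a : setpart n := pull swap a.

Lemma upper_ker_flip a : upper_ker (flip a) =2 lower_ker a.
Proof. by move=> x y; rewrite /upper_ker same_block_pull. Qed.

Lemma lower_ker_flip a : lower_ker (flip a) =2 upper_ker a.
Proof. by move=> x y; rewrite /lower_ker same_block_pull. Qed.

Lemma rank_flip a : rank a = 0 -> rank (flip a) = 0.
Proof.
move/eqP/rank0P=> no_a; apply/eqP/rank0P=> x y.
by rewrite /through same_block_pull same_block_sym; apply: no_a.
Qed.

Lemma sized_flip Q a : a \in sized Q n -> flip a \in sized Q n.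
Proof.
rewrite !inE => /forallP Qa; apply/forallP=> u.
have -> : pblock (flip a) u = swap @: pblock a (swap u).
  apply/setP=> v; rewrite -[v in RHS]swapK mem_imset; last exact: can_inj swapK.
  by rewrite !mem_block same_block_pull.
by rewrite card_imset //; apply: can_inj swapK.
Qed.

Lemma idempotent_rank0 a : rank a = 0 -> idempotent_part a.
Proof.
move=> a0; apply/eqP/rank0_eq => //; first exact: rank_pmul.
  exact: upper_ker_pmul.
exact: lower_ker_pmul.
Qed.

Variable Q : pred nat.
Hypotheses (Q2 : Q 2)
  (mulQ : forall a b, a \in sized Q n -> b \in sized Q n ->
     pmul a b \in sized Q n).
Let S := sized Q n.

Lemma mem_right_ideal a : a \in right_ideal S a.
Proof. by apply/imsetP; exists (id_part n); rewrite ?sized_id ?pmul_id. Qed.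

Lemma D0P a : reflect (a \in S /\ rank a = 0) (a \in D_ 0 S).
Proof. by apply: (iffP setIdP) => -[aS /eqP]. Qed.

(** Multiplication on the right does not change the upper pattern of a
    partition of rank 0, which is therefore an invariant of its right ideal.
    Conversely, if c and d have rank 0 and the same upper pattern, then c * s
    = d * (c * s) for all s: the right side takes its upper pattern from d,
    which is that of c, and its lower pattern from c * s. *)
Lemma greenR_D0 a b : a \in D_ 0 S -> b \in S ->
  greenR S a b = (b \in D_ 0 S) && [forall x, forall y,
    upper_ker a x y == upper_ker b x y].
Proof.
case/D0P=> aS a0 bS; apply/eqP/andP => [eq_ab | [/D0P[_ b0] /forallP eqU]].
  have := mem_right_ideal b; rewrite -eq_ab => /imsetP[s sS def_b]; split.
    by apply/D0P; rewrite bS def_b rank_pmul.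
  apply/forallP=> x; apply/forallP=> y.
  by rewrite def_b upper_ker_pmul.
have {}eqU x y : upper_ker a x y = upper_ker b x y.
  by have /forallP/(_ y)/eqP := eqU x.
have sub c d : c \in S -> rank c = 0 -> rank d = 0 ->
    upper_ker c =2 upper_ker d -> right_ideal S c \subset right_ideal S d.
  move=> cS c0 d0 eqcd; apply/subsetP=> _ /imsetP[s sS ->].
  apply/imsetP; exists (pmul c s); first exact: mulQ.
  have cs0 : rank (pmul c s) = 0 by apply: rank_pmul.
  apply: (rank0_eq cs0 (rank_pmul _ d0)) => x y.
    by rewrite !upper_ker_pmul.
  by rewrite [RHS]lower_ker_pmul.
by apply/eqP; rewrite eqEsubset !sub // => x y; rewrite eqU.
Qed.

Definition Rclass a : {set setpart n} := [set b in S | greenR S a b].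

Lemma Rclass_upper a b : a \in D_ 0 S -> b \in D_ 0 S ->
  Rclass a = Rclass b <-> upper_ker a =2 upper_ker b.
Proof.
move=> aD bD; have [aS a0] := D0P _ aD; have [bS b0] := D0P _ bD.
split=> [eqR x y | eqU].
  have : b \in Rclass a by rewrite eqR; apply/setIdP; rewrite /greenR eqxx.
  case/setIdP=> _; rewrite greenR_D0 //.
  case/andP=> _ /forallP/(_ x)/forallP/(_ y).
  by move/eqP.
apply/setP=> c; rewrite in_set [RHS]in_set; case cS: (c \in S) => //=.
rewrite !greenR_D0 //; congr andb.
by apply: eq_forallb => x; apply: eq_forallb => y; rewrite eqU.
Qed.

Lemma Rclasses_D0 : [set C in Rclasses S | C \subset D_ 0 S] = Rclass @: D_ 0 S.
Proof.
apply/setP=> C; rewrite inE.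
apply/andP/imsetP => [[/imsetP[a aS ->]]|[a aD ->]].
  move/subsetP=> subD; exists a => //; apply: subD.
  by apply/setIdP; rewrite /greenR eqxx.
have [aS _] := D0P _ aD; split; first exact: imset_f.
by apply/subsetP=> b /setIdP[bS]; rewrite greenR_D0 // => /andP[].
Qed.

(** A partition of rank 0 is idempotent, and is an arbitrary pair of an upper
    and a lower pattern. By [Rclass_upper] its R-class records the upper
    pattern; the R-class of its reflection records the lower one. Any two
    patterns occur together, in the product of a and the reflection of b. *)
Lemma idempotents_rank0 : e_ (D_ 0 S) = rho S ^ 2.
Proof.
have -> : e_ (D_ 0 S) = #|D_ 0 S|.
  apply: eq_card => a; rewrite inE andb_idr // => /D0P[_ a0].
  exact: idempotent_rank0.
rewrite /rho Rclasses_D0 -mulnn -cardsX.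
have flipD a : a \in D_ 0 S -> flip a \in D_ 0 S.
  by case/D0P=> aS a0; apply/D0P; rewrite rank_flip // sized_flip.
have class_inj :
    {in D_ 0 S &, injective (fun a => (Rclass a, Rclass (flip a)))}.
  move=> a b aD bD [/(Rclass_upper aD bD) eqU].
  move/(Rclass_upper (flipD _ aD) (flipD _ bD)) => eqL.
  have [[_ a0] [_ b0]] := (D0P _ aD, D0P _ bD).
  by apply: rank0_eq => // x y; have := eqL x y; rewrite !upper_ker_flip.
rewrite -(card_in_imset class_inj); congr #|pred_of_set _|.
apply/setP=> -[C C']; rewrite in_setX; apply/imsetP/andP => /=.
  by case=> a aD [-> ->]; split; apply: imset_f => //; apply: flipD.
case=> /imsetP[a aD ->] /imsetP[b bD ->].
have [[aS a0] [fS f0]] := (D0P _ aD, D0P _ (flipD _ bD)).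
have abD : pmul a (flip b) \in D_ 0 S.
  by apply/D0P; rewrite rank_pmul // mulQ.
exists (pmul a (flip b)) => //; congr pair; apply/Rclass_upper => //.
- by move=> x y; rewrite upper_ker_pmul.
- exact: flipD.
- by move=> x y; rewrite upper_ker_flip lower_ker_pmul // lower_ker_flip.
Qed.

End RankZero.

Lemma idempotents_rank_n (Q : pred nat) n : Q 2 -> e_ (D_ n (sized Q n)) = 1.
Proof.
move=> Q2; apply/eqP/cards1P; exists (id_part n); apply/setP=> a.
rewrite in_set in_set in_set1 -idempotent_rank_n andbAC -andbA.
rewrite andb_idl // => /andP[id_a rk_a].
have /eqP-> : a == id_part n by rewrite -idempotent_rank_n id_a.
exact: sized_id.
Qed.

Lemma idempotent_numbers (K : forall n : nat, {set setpart n}) (Q : pred nat)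
    (n : nat) :
    (forall m, K m = sized Q m) -> Q 2 ->
    (forall a b, a \in sized Q n -> b \in sized Q n ->
       pmul a b \in sized Q n) ->
  [/\ e_ (D_ n (K n)) = 1,
      e_ (D_ 0 (K n)) = rho (K n) ^ 2 &
      forall r : nat, 1 <= r <= n - 1 ->
        e_ (D_ r (K n)) =
        \sum_(1 <= m < n.+1)
          'C(n - 1, m - 1) *
          (c_ 0 (K m) * e_ (D_ r (K (n - m))) +
           c_ 1 (K m) * e_ (D_ (r - 1) (K (n - m))))].
Proof.
move=> defK Q2 mulQ; rewrite defK; split.
- exact: idempotents_rank_n.
- exact: idempotents_rank0.
move=> r /andP[r_gt0 le_rn]; rewrite recurrence //; last first.
  by case: (n) (leq_trans r_gt0 le_rn).
by apply: eq_bigr => m _; rewrite !defK.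
Qed.

Theorem theorem10 (K : forall n : nat, {set setpart n})
    (hK : [\/ K = P_, K = B_ | K = PB_]) (n : nat) :
  [/\ e_ (D_ n (K n)) = 1,
      e_ (D_ 0 (K n)) = rho (K n) ^ 2 &
      forall r : nat, 1 <= r <= n - 1 ->
        e_ (D_ r (K n)) =
        \sum_(1 <= m < n.+1)
          'C(n - 1, m - 1) *
          (c_ 0 (K m) * e_ (D_ r (K (n - m))) +
           c_ 1 (K m) * e_ (D_ (r - 1) (K (n - m))))].
Proof.
case: hK => ->.
- apply: (@idempotent_numbers _ predT) => // [m | a b _ _].
    by apply/setP=> a; rewrite !inE; apply/esym/forallP.
  by rewrite inE; apply/forallP.
- apply: (@idempotent_numbers _ (eq_op^~ 2)) => // [m|]; last first.
    exact: sized_eq2_pmul.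
  by apply/setP=> a; rewrite !inE; apply: (forall_blocks a (eq_op^~ 2)).
- apply: (@idempotent_numbers _ (leq^~ 2)) => // [m|]; last first.
    exact: sized_le2_pmul.
  by apply/setP=> a; rewrite !inE; apply: (forall_blocks a (leq^~ 2)).
Qed.
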